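(* Let $N\ge0$ be an integer (the cut-off $N_{cut}$) and let $n_F\in\{0,1,2,3,4\}$. Let $d^{n_F}$ be the number of fermionic bricks in the sector with $n_F$ fermions of the $SU(3)$ model and let $n_B^\alpha(n_F)$, $1\le\alpha\le d^{n_F}$, be the number of bosonic creation operators in the $\alpha$-th brick. Then the set of eigenvalues $E$ of the cut Hamiltonian $H_N^{(n_F)}$ in the gauge-invariant sector with $n_F$ fermions is exactly the set of roots of $$\Theta^{n_F}_{N}(E)=\prod_{\alpha=1}^{d^{n_F}}\ \prod_{k=0}^{\lfloor\frac13(N-n_B^\alpha(n_F))\rfloor}L^{3k+3+n_B^\alpha(n_F)}_{\lfloor\frac12(N-3k-n_B^\alpha(n_F))\rfloor+1}(2E),$$ where the inner product is empty (equal to $1$) if $N<n_B^\alpha(n_F)$.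
   Context: Model. Let $A=1,\dots,8$ label the generators $T^A$ of $SU(3)$ in the fundamental representation, $\mathrm{tr}(T^AT^B)=\frac12\delta_{AB}$. Operators satisfy $[a_A,a_B^\dagger]=\delta_{AB}$, $\{f_A,f_B^\dagger\}=\delta_{AB}$, all other (anti)commutators vanishing, bosonic and fermionic operators commuting; $|0\rangle$ is the Fock vacuum ($a_A|0\rangle=f_A|0\rangle=0$). Put $a=\sum_Aa_AT^A$, $a^\dagger=\sum_Aa_A^\dagger T^A$, $f^\dagger=\sum_Af_A^\dagger T^A$, and write $(O)$ for the trace of a product of such matrices. The Hamiltonian is $H=(a^\dagger a)+2-\frac12(a^\dagger a^\dagger)-\frac12(aa)$. $SU(3)$ acts simultaneously on all operators by the adjoint action; gauge-invariant means $SU(3)$-invariant. Cut Hamiltonian. $V_N^{(n_F)}$ is the (finite-dimensional) space of gauge-invariant Fock states with exactly $n_F$ fermionic quanta and at most $N$ bosonic quanta, and $H_N^{(n_F)}=P_NH|_{V_N^{(n_F)}}$, where $P_N$ is the projection discarding all components with more than $N$ bosonic quanta. Fermionic bricks. For $n_F=0$ there is a single trivial brick, $1$. The bricks are (writing $f,a$ for $f^\dagger,a^\dagger$): $n_F=1$: $(fa)$, $(faa)$; $n_F=2$: $(ffa)$, $(ffaa)$, $(faafa)$, $(fa)(faa)$; $n_F=3$: $(fff)$, $(fffa)$, $(fffaa)$, $(fa)(ffa)$, $(faffaa)$, $(fa)(ffaa)$, $(faa)(ffa)$, $(faa)(ffaa)$; $n_F=4$: $(ffffa)$, $(fa)(fff)$,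 $(ffffaa)$, $(faa)(fff)$, $(fa)(afff)$, $(ffa)(ffa)$, $(faa)(fffa)$, $(ffa)(ffaa)$, $(fa)(faa)(ffa)$, $(ffa)(fafaa)$. Hence the multisets of $n_B^\alpha(n_F)$ are: $\{0\}$; $\{1,2\}$; $\{1,2,3,3\}$; $\{0,1,2,2,3,3,3,4\}$; $\{1,1,2,2,2,2,3,3,4,4\}$ for $n_F=0,1,2,3,4$ respectively. It is known (and taken as given) that the vectors $C^\dagger_\alpha(a^\dagger a^\dagger)^j(a^\dagger a^\dagger a^\dagger)^k|0\rangle$, with $C^\dagger_\alpha$ the bricks of the sector and $2j+3k+n_B^\alpha\le N$, form a basis of $V_N^{(n_F)}$. Rescaled Laguerre polynomials: $L_n^\alpha(x)=\sum_{i=0}^n\frac{(-x)^i}{i!\,(n-i)!\,\Gamma(\alpha+i+1)}$. *)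

(* Defs.v *)
From mathcomp Require Import all_boot all_order all_algebra.
From mathcomp Require Import sesquilinear spectral mpoly.

Set Implicit Arguments.
Unset Strict Implicit.
Unset Printing Implicit Defensive.

Import Order.TTheory GRing.Theory Num.Theory.
Local Open Scope ring_scope.
Local Open Scope sesquilinear_scope.

(* C stands for the field of complex numbers; it is R[i], with R : realType,  *)
(* in the theorem.  The adjoint index A = 1..8 is encoded as A : 'I_8.        *)

(* A finite combination of Fock states, written uniquely as                   *)
(*   \sum_S p_S(a^dagger) f_S^dagger |0>,                                     *)
(* where f_S^dagger is the product of the f_A^dagger, A in S, in increasing   *)
(* order, is encoded by its family of polynomials S |-> p_S.                  *)
Definition fock (C : numClosedFieldType) := {ffun {set 'I_8} -> {mpoly C[8]}}.

Definition operator (C : numClosedFieldType) := fock C -> fock C.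

Definition vacuum {C : numClosedFieldType} : fock C :=
  [ffun S : {set 'I_8} => if S == set0 then 1 else 0].

Definition creB {C : numClosedFieldType} (A : 'I_8) (psi : fock C) : fock C :=
  [ffun S : {set 'I_8} => 'X_A * psi S].

Definition annB {C : numClosedFieldType} (A : 'I_8) (psi : fock C) : fock C :=
  [ffun S : {set 'I_8} => (psi S)^`M(A)].

(* Sign produced when f_A^(dagger) is moved to position A inside f_S^dagger.  *)
Definition fsign {C : numClosedFieldType} (A : 'I_8) (S : {set 'I_8}) : C :=
  (-1) ^+ #|[set B in S | (B < A)%N]|.

Definition creF {C : numClosedFieldType} (A : 'I_8) (psi : fock C) : fock C :=
  [ffun S : {set 'I_8} => if A \in S then fsign A S *: psi (S :\ A) else 0].

Definition annF {C : numClosedFieldType} (A : 'I_8) (psi : fock C) : fock C :=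
  [ffun S : {set 'I_8} => if A \in S then 0 else fsign A S *: psi (A |: S)].

(* The state obtained from psi by keeping the vacuum and putting cB A, cF A   *)
(* in place of a_A^dagger, f_A^dagger (see fock_substE).                      *)
Definition fock_monomial {C : numClosedFieldType} (cB cF : 'I_8 -> operator C)
    (S : {set 'I_8}) (m : 'X_{1..8}) : fock C :=
  foldr (fun A phi => iter (m A) (cB A) phi)
        (foldr cF vacuum (enum S)) (enum 'I_8).

Definition fock_subst {C : numClosedFieldType} (cB cF : 'I_8 -> operator C)
    (psi : fock C) : fock C :=
  \sum_(S : {set 'I_8}) \sum_(m <- msupp (psi S))
    (psi S)@_m *: fock_monomial cB cF S m.

Definition su3_generators {C : numClosedFieldType}
    (T : 'I_8 -> 'M[C]_3) : Prop :=
  [/\ forall A, (T A)^t* = T A,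
      forall A, \tr (T A) = 0
    & forall A B, \tr (T A *m T B) = 2^-1 * (A == B)%:R].

Definition SU3 {C : numClosedFieldType} (g : 'M[C]_3) : Prop :=
  g \is unitarymx /\ \det g = 1.

(* g T^A g^dagger = \sum_B (adjoint_coef T g B A) T^B for g in SU(3).         *)
Definition adjoint_coef {C : numClosedFieldType} (T : 'I_8 -> 'M[C]_3)
    (g : 'M[C]_3) (B A : 'I_8) : C :=
  2 * \tr (T B *m (g *m T A *m g^t*)).

Definition rotate {C : numClosedFieldType} (T : 'I_8 -> 'M[C]_3) (g : 'M[C]_3)
    (c : 'I_8 -> operator C) (A : 'I_8) (psi : fock C) : fock C :=
  \sum_B adjoint_coef T g B A *: c B psi.

(* The action fixing the vacuum and conjugating a_A^dagger into               *)
(* \sum_B (adjoint_coef T g B A) a_B^dagger, and likewise for f^dagger.       *)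
Definition gauge_act {C : numClosedFieldType} (T : 'I_8 -> 'M[C]_3)
    (g : 'M[C]_3) : operator C :=
  fock_subst (rotate T g creB) (rotate T g creF).

Definition gauge_invariant {C : numClosedFieldType} (T : 'I_8 -> 'M[C]_3)
    (psi : fock C) : Prop :=
  forall g, SU3 g -> gauge_act T g psi = psi.

(* 3 x 3 matrices whose entries are operators, and (O_1 O_2 ...) , the trace  *)
(* of the product of the matrices O_l = \sum_A (O_l)_A T^A.                   *)
Definition opmx (C : numClosedFieldType) := 'I_3 -> 'I_3 -> operator C.

Definition opmx_of {C : numClosedFieldType} (T : 'I_8 -> 'M[C]_3)
    (O : 'I_8 -> operator C) : opmx C :=
  fun i j psi => \sum_A T A i j *: O A psi.

Definition opmx1 {C : numClosedFieldType} : opmx C :=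
  fun i j psi => (i == j)%:R *: psi.

Definition opmx_mul {C : numClosedFieldType} (M N : opmx C) : opmx C :=
  fun i j psi => \sum_k M i k (N k j psi).

Definition optrace {C : numClosedFieldType} (T : 'I_8 -> 'M[C]_3)
    (w : seq ('I_8 -> operator C)) (psi : fock C) : fock C :=
  \sum_i foldr opmx_mul opmx1 (map (opmx_of T) w) i i psi.

Definition hamiltonian {C : numClosedFieldType} (T : 'I_8 -> 'M[C]_3)
    (psi : fock C) : fock C :=
  optrace T [:: creB; annB] psi + 2 *: psi
  - 2^-1 *: optrace T [:: creB; creB] psi
  - 2^-1 *: optrace T [:: annB; annB] psi.

Definition cut_proj {C : numClosedFieldType} (N : nat) (psi : fock C) :
    fock C :=
  [ffun S : {set 'I_8} =>
    \sum_(m <- msupp (psi S) | (mdeg m <= N)%N) (psi S)@_m *: 'X_[m]].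

Definition sector {C : numClosedFieldType} (T : 'I_8 -> 'M[C]_3) (N nF : nat)
    (psi : fock C) : Prop :=
  [/\ gauge_invariant T psi,
      forall S : {set 'I_8}, psi S != 0 -> #|S| = nF
    & forall (S : {set 'I_8}) (m : 'X_{1..8}),
        m \in msupp (psi S) -> (mdeg m <= N)%N].

Definition cut_eigenvalue {C : numClosedFieldType} (T : 'I_8 -> 'M[C]_3)
    (N nF : nat) (E : C) : Prop :=
  exists psi : fock C,
    [/\ sector T N nF psi, psi != 0
      & cut_proj N (hamiltonian T psi) = E *: psi].

(* A brick is a product of traces of words in the matrices f^dagger (letter   *)
(* Fd) and a^dagger (letter Ad).                                              *)
Inductive letter := Fd | Ad.

Definition letter_op {C : numClosedFieldType} (l : letter) :
    'I_8 -> operator C :=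
  if l is Fd then creF else creB.

Definition brick := seq (seq letter).

Definition bricks (nF : nat) : seq brick :=
  match nF with
  | 0 => [:: [::]]
  | 1 => [:: [:: [:: Fd; Ad]];
             [:: [:: Fd; Ad; Ad]]]
  | 2 => [:: [:: [:: Fd; Fd; Ad]];
             [:: [:: Fd; Fd; Ad; Ad]];
             [:: [:: Fd; Ad; Ad; Fd; Ad]];
             [:: [:: Fd; Ad]; [:: Fd; Ad; Ad]]]
  | 3 => [:: [:: [:: Fd; Fd; Fd]];
             [:: [:: Fd; Fd; Fd; Ad]];
             [:: [:: Fd; Fd; Fd; Ad; Ad]];
             [:: [:: Fd; Ad]; [:: Fd; Fd; Ad]];
             [:: [:: Fd; Ad; Fd; Fd; Ad; Ad]];
             [:: [:: Fd; Ad]; [:: Fd; Fd; Ad; Ad]];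
             [:: [:: Fd; Ad; Ad]; [:: Fd; Fd; Ad]];
             [:: [:: Fd; Ad; Ad]; [:: Fd; Fd; Ad; Ad]]]
  | 4 => [:: [:: [:: Fd; Fd; Fd; Fd; Ad]];
             [:: [:: Fd; Ad]; [:: Fd; Fd; Fd]];
             [:: [:: Fd; Fd; Fd; Fd; Ad; Ad]];
             [:: [:: Fd; Ad; Ad]; [:: Fd; Fd; Fd]];
             [:: [:: Fd; Ad]; [:: Ad; Fd; Fd; Fd]];
             [:: [:: Fd; Fd; Ad]; [:: Fd; Fd; Ad]];
             [:: [:: Fd; Ad; Ad]; [:: Fd; Fd; Fd; Ad]];
             [:: [:: Fd; Fd; Ad]; [:: Fd; Fd; Ad; Ad]];
             [:: [:: Fd; Ad]; [:: Fd; Ad; Ad]; [:: Fd; Fd; Ad]];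
             [:: [:: Fd; Fd; Ad]; [:: Fd; Ad; Fd; Ad; Ad]]]
  | _ => [::]
  end.

Definition nB (b : brick) : nat :=
  count (fun l => if l is Ad then true else false) (flatten b).

Definition brick_op {C : numClosedFieldType} (T : 'I_8 -> 'M[C]_3) (b : brick)
    (psi : fock C) : fock C :=
  foldr (fun w phi => optrace T (map letter_op w) phi) psi b.

Definition brick_vec {C : numClosedFieldType} (T : 'I_8 -> 'M[C]_3) (b : brick)
    (j k : nat) : fock C :=
  brick_op T b (iter j (optrace T [:: creB; creB])
                 (iter k (optrace T [:: creB; creB; creB]) vacuum)).

Definition is_basis {C : numClosedFieldType} (V : fock C -> Prop) (I : finType)
    (P : pred I) (v : I -> fock C) : Prop :=
  [/\ forall i, P i -> V (v i),
      forall c : I -> C,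
        \sum_(i | P i) c i *: v i = 0 -> forall i, P i -> c i = 0
    & forall psi, V psi -> exists c : I -> C,
        psi = \sum_(i | P i) c i *: v i].

(* Taking j, k <= N loses no (j, k) with 2 j + 3 k + nB <= N.                 *)
Definition brick_basis {C : numClosedFieldType} (T : 'I_8 -> 'M[C]_3)
    (N nF : nat) : Prop :=
  is_basis (sector T N nF)
    (fun x : 'I_(size (bricks nF)) * 'I_N.+1 * 'I_N.+1 =>
       (2 * x.1.2 + 3 * x.2 + nB (nth [::] (bricks nF) x.1.1) <= N)%N)
    (fun x => brick_vec T (nth [::] (bricks nF) x.1.1) x.1.2 x.2).

(* The index alpha is a natural number, so Gamma (alpha + i + 1) is           *)
(* (alpha + i)!.                                                              *)
Definition laguerre {C : numClosedFieldType} (n alpha : nat) : {poly C} :=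
  \poly_(i < n.+1) ((-1) ^+ i / (i`! * (n - i)`! * (alpha + i)`!)%:R).

Definition Theta {C : numClosedFieldType} (N nF : nat) : {poly C} :=
  \prod_(b <- bricks nF | (nB b <= N)%N)
    \prod_(0 <= k < ((N - nB b) %/ 3).+1)
      (laguerre ((N - 3 * k - nB b) %/ 2).+1 (3 * k + 3 + nB b)
         \Po (2 *: 'X)).


Lemma annB_creB (C : numClosedFieldType) (A B : 'I_8) (psi : fock C) :
  annB A (creB B psi) - creB B (annB A psi) = (A == B)%:R *: psi.
Proof.
apply/ffunP=> S; rewrite !ffunE mderivM mderivX mnm1E addrK.
case: (B =P A) => [->|/eqP nBA].
  have -> : (U_(A) - U_(A) = 0 :> 'X_{1..8})%MM.
    by apply/mnmP=> D; rewrite mnmBE subnn mnm0E.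
  by rewrite eqxx scale1r mpolyX0 mul1r scale1r.
by rewrite eq_sym (negPf nBA) !scale0r mul0r.
Qed.

Lemma creB_creB (C : numClosedFieldType) (A B : 'I_8) (psi : fock C) :
  creB A (creB B psi) = creB B (creB A psi).
Proof. by apply/ffunP=> S; rewrite !ffunE mulrCA. Qed.

Lemma annB_annB (C : numClosedFieldType) (A B : 'I_8) (psi : fock C) :
  annB A (annB B psi) = annB B (annB A psi).
Proof. by apply/ffunP=> S; rewrite !ffunE mderiv_comm. Qed.

Lemma fsign_setD1 (C : numClosedFieldType) (A B : 'I_8) (S : {set 'I_8}) :
  B \in S -> fsign A S = (-1) ^+ (B < A)%N * fsign A (S :\ B) :> C.
Proof.
move=> BS; rewrite /fsign (cardsD1 B) inE BS exprD.
congr (_ * (-1) ^+ #|pred_of_set _|).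
by apply/setP=> D; rewrite !inE andbA.
Qed.

Lemma sign_ltn (C : numClosedFieldType) (A B : 'I_8) :
  A != B -> (-1) ^+ (A < B)%N = - (-1) ^+ (B < A)%N :> C.
Proof.
rewrite -val_eqE /= neq_ltn => /orP[] lt; rewrite lt ltnNge (ltnW lt) /=.
  by rewrite expr1 expr0.
by rewrite expr1 expr0 opprK.
Qed.

Lemma creF_creF (C : numClosedFieldType) (A B : 'I_8) (psi : fock C) :
  creF A (creF B psi) + creF B (creF A psi) = 0.
Proof.
apply/ffunP=> S; rewrite !ffunE !inE.
case: (A =P B) => [<-|/eqP nAB]; first by rewrite eqxx scaler0 if_same addr0.
rewrite [B == A]eq_sym nAB /=.
have [AS|_] := boolP (A \in S); have [BS|_] := boolP (B \in S);
  rewrite ?scaler0 ?addr0 //.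
rewrite !setDDl [[set B] :|: _]setUC !scalerA -scalerDl.
rewrite (fsign_setD1 C A BS) (fsign_setD1 C B AS).
suff -> : (-1) ^+ (A < B)%N = - (-1) ^+ (B < A)%N :> C.
  by rewrite !mulNr -!mulrA [fsign B _ * _]mulrC addrN scale0r.
exact: sign_ltn.
Qed.

Lemma annF_annF (C : numClosedFieldType) (A B : 'I_8) (psi : fock C) :
  annF A (annF B psi) + annF B (annF A psi) = 0.
Proof.
apply/ffunP=> S; rewrite !ffunE !inE.
case: (A =P B) => [<-|/eqP nAB]; first by rewrite eqxx /= scaler0 if_same addr0.
rewrite [B == A]eq_sym (negPf nAB) /=.
have [AS|AS] := boolP (A \in S); have [BS|BS] := boolP (B \in S);
  rewrite ?scaler0 ?addr0 //.
have AB : A \in A |: S by rewrite setU11.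
have BA : B \in B |: S by rewrite setU11.
rewrite !setUA [[set B] :|: _]setUC !scalerA -scalerDl.
rewrite (fsign_setD1 C A BA) (fsign_setD1 C B AB) !setU1K //.
suff -> : (-1) ^+ (A < B)%N = - (-1) ^+ (B < A)%N :> C.
  rewrite mulNr mulrN (mulrCA (fsign A S)) (mulrCA (fsign B S)).
  by rewrite (mulrC (fsign A S)) addNr scale0r.
exact: sign_ltn.
Qed.

Lemma fsign_sqr (C : numClosedFieldType) (A : 'I_8) (S : {set 'I_8}) :
  fsign A S * fsign A S = 1 :> C.
Proof. by rewrite -expr2 sqrr_sign. Qed.

Lemma annF_creF (C : numClosedFieldType) (A B : 'I_8) (psi : fock C) :
  annF A (creF B psi) + creF B (annF A psi) = (A == B)%:R *: psi.
Proof.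
apply/ffunP=> S; rewrite !ffunE !inE.
case: (A =P B) => [<-|/eqP nAB].
  rewrite eqxx /= scale1r; have [AS|AS] := boolP (A \in S).
    rewrite add0r setD1K // scalerA -{2}[psi S]scale1r; congr (_ *: _).
    by rewrite (fsign_setD1 C A AS) ltnn mul1r fsign_sqr.
  rewrite addr0 setU1K // scalerA -{2}[psi S]scale1r; congr (_ *: _).
  have AB : A \in A |: S by rewrite setU11.
  by rewrite (fsign_setD1 C A AB) ltnn mul1r setU1K // fsign_sqr.
rewrite [B == A]eq_sym (negPf nAB) /= scale0r.
have [AS|AS] := boolP (A \in S); have [BS|BS] := boolP (B \in S);
  rewrite ?scaler0 ?addr0 //.
have AB : A \in A |: S by rewrite setU11.
have -> : (A |: S) :\ B = A |: (S :\ B).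
  by apply/setP=> D; rewrite !inE; case: (D =P A) => //= ->; rewrite nAB.
rewrite !scalerA -scalerDl (fsign_setD1 C B AB) setU1K // (fsign_setD1 C A BS).
suff -> : (-1) ^+ (A < B)%N = - (-1) ^+ (B < A)%N :> C.
  by rewrite mulNr mulrN mulrACA -expr2 sqrr_sign mul1r mulrC addNr scale0r.
exact: sign_ltn.
Qed.

Lemma foldr_creF (C : numClosedFieldType) (s : seq 'I_8) :
  sorted (fun A B : 'I_8 => (A < B)%N) s ->
  foldr creF vacuum s = [ffun S => if S == [set:: s] then 1 else 0] :> fock C.
Proof.
have ltn_tr : transitive (fun A B : 'I_8 => (A < B)%N).
  by move=> A B D; apply: ltn_trans.
elim: s => [_|A s IHs As] /=.
  by apply/ffunP=> S; rewrite !ffunE.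
rewrite IHs ?(path_sorted As) //.
have lt_s B : B \in s -> (A < B)%N.
  by move: As; rewrite /= (path_sortedE ltn_tr) => /andP[/allP + _]; apply.
have nAs : A \notin [set:: s] by rewrite inE; apply/negP=> /lt_s; rewrite ltnn.
apply/ffunP=> S; rewrite !ffunE set_cons.
have [AS|AS] := boolP (A \in S); last first.
  by case: eqP AS => // ->; rewrite setU11.
have -> : (S :\ A == [set:: s]) = (S == A |: [set:: s]).
  apply/eqP/eqP => [<-|->]; first by rewrite setD1K.
  by rewrite setU1K.
case: eqP => [->|_]; last by rewrite scaler0.
rewrite /fsign (_ : [set B in _ | _] = set0) ?cards0 ?scale1r //.
apply/setP=> B; rewrite !inE; case: eqP => [->|_] /=; first by rewrite ltnn.
by apply/negP=> /andP[/lt_s lt lt']; have := ltn_trans lt lt'; rewrite ltnn.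
Qed.

Lemma fock_sumE (C : numClosedFieldType) (I : Type) (r : seq I) (P : pred I)
    (v : I -> fock C) (S : {set 'I_8}) :
  (\sum_(i <- r | P i) v i) S = \sum_(i <- r | P i) v i S.
Proof. by elim/big_rec2: _ => [|i p phi _ <-]; rewrite !ffunE. Qed.

Lemma fock_substE (C : numClosedFieldType) (psi : fock C) :
  fock_subst creB creF psi = psi.
Proof.
have bE (m : 'X_{1..8}) (phi : fock C) (S : {set 'I_8}) (s : seq 'I_8) :
    (foldr (fun A phi => iter (m A) (creB A) phi) phi s) S =
    (\prod_(A <- s) 'X_A ^+ m A) * phi S.
  elim: s => [|A s IHs] /=; first by rewrite big_nil mul1r.
  rewrite big_cons -mulrA -IHs; elim: (m A) => [|k IHk] /=.
    by rewrite expr0 mul1r.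
  by rewrite ffunE IHk exprS mulrA.
have enum_sorted (S : {set 'I_8}) :
    sorted (fun A B : 'I_8 => (A < B)%N) (enum S).
  have : sorted ltn (map val (enum S)).
    apply: (subseq_sorted ltn_trans _ (iota_ltn_sorted 0 8)).
    rewrite -val_enum_ord; apply: map_subseq.
    by rewrite [enum 'I_8]enumT; apply: filter_subseq.
  by rewrite sorted_map.
suff E (S : {set 'I_8}) : fock_subst creB creF psi S = psi S by apply/ffunP.
rewrite /fock_subst fock_sumE (bigD1 S) //= [X in _ + X]big1 => [|S' nS].
  rewrite addr0 fock_sumE [RHS]mpolyE; apply: eq_bigr => m _.
  rewrite ffunE /fock_monomial bE foldr_creF // ffunE set_enum eqxx mulr1.
  by rewrite [in RHS]mpolyXE_id big_enum.
rewrite fock_sumE big1 // => m _; rewrite ffunE /fock_monomial bE foldr_creF //.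
by rewrite ffunE set_enum eq_sym (negPf nS) mulr0 scaler0.
Qed.

(* Main.v *)
From HB Require Import structures.
Require Import Defs.
From mathcomp Require Import all_boot all_order all_algebra.
From mathcomp Require Import reals complex.
From mathcomp Require Import sesquilinear spectral mpoly ring zify.

(* Write a basis vector as s^j p with s = (a^dagger a^dagger) and p a brick   *)
(* times a power of (a^dagger a^dagger a^dagger), of bosonic degree d.  Then  *)
(* s raises j, the number operator is d + 2 j, and                            *)
(*   Laplacian (s^j p) = s^j Laplacian p + 2 j (j + 3 + d) s^(j-1) p.         *)
(* The Laplacian commutes with the adjoint action, which is orthogonal by the *)
(* completeness of the T^A, so Laplacian p is again a combination of basis    *)
(* vectors, all of degree d - 2.  Hence H_N is block triangular for the order *)
(* by d, one tridiagonal block per p, and the three-term recurrence of its    *)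
(* eigenvectors is that of j |-> L_j^(d+3)(2 E); the cut at j = J imposes     *)
(* L_(J+1)^(d+3)(2 E) = 0.                                                    *)

Set Implicit Arguments.
Unset Strict Implicit.
Unset Printing Implicit Defensive.

Import Order.TTheory GRing.Theory Num.Theory.
Local Open Scope ring_scope.

(** In the polynomial model H is half the number operator, plus 2, minus s/2, minus a quarter of the
    Laplacian ([hamiltonianE]). Multiplication by s, the number operator and the Laplacian close
    under commutators, as in sl(2). If p were harmonic of degree d, the vectors s^j p would carry a
    Jacobi matrix, whose truncation has as eigenvalues the zeros of a single Laguerre polynomial
    ([laguerre_rec_unique]).

    The p at hand need not be harmonic, but [laplacian p] is gauge invariant, hence expands in the
    basis ([laplacian_gauge_act], resting on [mxtrace_sum_generators]), and has degree d - 2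
    ([number_op_laplacian]). It therefore only feeds blocks of smaller d, and the spectrum is the
    union of the spectra of the diagonal blocks. Only the set of eigenvalues matters, so
    [block_tridiag_eigenvalue] constructs eigenvectors and needs no determinant.
    [cut_eigenvalue_laguerre] transports this to Fock space, and [root_Theta] identifies the blocks
    with the factors of [Theta]. *)

(** * Laguerre polynomials and the three-term recurrence *)

Lemma coef_laguerre (C : numClosedFieldType) (n a i : nat) :
  (laguerre n a : {poly C})`_i =
    if (i <= n)%N then (-1) ^+ i / (i`! * (n - i)`! * (a + i)`!)%:R else 0.
Proof. by rewrite coef_poly ltnS. Qed.

(** The classical recurrence divided through by factorials: [laguerre n a] is the usual polynomial
    over (n + a)!. The factor [(0 < n)%:R] removes the spurious term that [n.-1] would give at n =
    0. *)
Lemma laguerre_rec (C : numClosedFieldType) (n a : nat) :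
  (n.+1 * (a + n.+1))%:R *: laguerre n.+1 a =
  (2 * n + 1 + a)%:R *: laguerre n a - 'X * laguerre n a
  - (0 < n)%:R *: laguerre n.-1 a :> {poly C}.
Proof.
have f0 k : (k`!%:R != 0 :> C) by rewrite pnatr_eq0 -lt0n fact_gt0.
have s1 k : (1 + k%:R != 0 :> C) by rewrite nat1r pnatr_eq0.
have s2 k m : (k.+1%:R + m%:R != 0 :> C) by rewrite -natrD pnatr_eq0.
have s3 k m : (1 + (k%:R + m%:R) != 0 :> C) by rewrite -natrD nat1r pnatr_eq0.
apply/polyP => i; rewrite !coefB !coefZ coefXM.
have -> : (0 < n)%:R * (laguerre n.-1 a : {poly C})`_i =
    if (i < n)%N then (-1) ^+ i / (i`! * (n - i).-1`! * (a + i)`!)%:R else 0.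
  case: n => [|n]; first by rewrite mul0r.
  rewrite mul1r coef_laguerre ltnS; case: leqP => // le_in.
  by rewrite subSn.
rewrite !coef_laguerre.
case: (ltngtP i n) => [lt_in|lt_ni|->].
(* This substitution removes the truncated subtractions, so that [field] applies. *)
- have [m ->] : exists m, n = (i + m).+1 by exists (n - i.+1)%N; lia.
  rewrite leqW; last by lia.
  have -> : ((i + m).+2 - i = m.+2)%N by lia.
  have -> : ((i + m).+1 - i = m.+1)%N by lia.
  case: i lt_in => [|i] lt_in /=.
    by rewrite !expr0 !factS; field; rewrite !f0 ?s1 ?s2 ?s3.
  rewrite ifT; last by lia.
  have -> : ((i.+1 + m).+1 - i = m.+2)%N by lia.
  rewrite (addnS a i) !factS !exprS.
  by field; rewrite !f0 ?s1 ?s2 ?s3.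
- rewrite subr0; case: (ltngtP i n.+1) => [|lt_Si|E]; first by lia.
    case: i lt_ni lt_Si => //= i _ lt_i.
    rewrite ifF; last by lia.
    by ring.
  rewrite E subnn /= leqnn subnn.
  rewrite (addnS a n) !factS !exprS.
  by field; rewrite !f0 ?s1 ?s2 ?s3.
rewrite leqW // subnn subSnn; case: n => [|n] /=.
  by rewrite ?addn0 ?expr0 !factS; field; rewrite !f0.
have -> : (n.+1 - n = 1)%N by lia.
rewrite leqnSn (addnS a n) !factS !exprS.
by field; rewrite !f0 ?s1 ?s2 ?s3.
Qed.

Lemma horner_laguerre_rec (C : numClosedFieldType) (a n : nat) (E : C) :
  E * (laguerre n a).[2 * E] =
  (2 * n + 1 + a)%:R / 2 * (laguerre n a).[2 * E]
  - 2^-1 * ((0 < n)%:R * (laguerre n.-1 a).[2 * E])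
  - 2^-1 * ((n.+1 * (a + n.+1))%:R * (laguerre n.+1 a).[2 * E]).
Proof.
have := congr1 (fun p => p.[2 * E]) (laguerre_rec C n a).
rewrite !(hornerD, hornerN, hornerZ, hornerM, hornerX) => ->.
by field.
Qed.

Lemma laguerre0 (C : numClosedFieldType) (a : nat) (x : C) :
  (laguerre 0 a).[x] = (a`!%:R)^-1.
Proof.
have -> : laguerre 0 a = ((a`!%:R)^-1)%:P :> {poly C}.
  apply/polyP => -[|i]; rewrite coef_laguerre coefC //=.
  by rewrite expr0 addn0 mul1n mul1r.
by rewrite hornerC.
Qed.

(** The coefficient of [e j.+1] never vanishes, so [e 0] determines the rest; a! compensates for L_0
    = 1/a!. The equation at J already fixes [e J.+1], where the cut condition is imposed. *)
Lemma laguerre_rec_unique (C : numClosedFieldType) (a J : nat) (E : C)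
    (e : nat -> C) :
  (forall j, (j <= J)%N -> E * e j = (2 * j + 1 + a)%:R / 2 * e j
    - 2^-1 * ((0 < j)%:R * e j.-1)
    - 2^-1 * ((j.+1 * (a + j.+1))%:R * e j.+1)) ->
  forall j, (j <= J.+1)%N -> e j = e 0 * a`!%:R * (laguerre j a).[2 * E].
Proof.
move=> eE; have f0 k : (k`!%:R != 0 :> C) by rewrite pnatr_eq0 -lt0n fact_gt0.
elim/ltn_ind=> -[_ _|j IHj lt_j].
  by rewrite laguerre0 mulfK.
have c0 : (j.+1 * (a + j.+1))%:R / 2 != 0 :> C.
  by rewrite mulf_neq0 ?invr_eq0 ?pnatr_eq0 // muln_eq0 /= addnS.
apply: (mulfI c0); have ej := eE j lt_j.
have -> : (j.+1 * (a + j.+1))%:R / 2 * e j.+1 =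
    (2 * j + 1 + a)%:R / 2 * e j - 2^-1 * ((0 < j)%:R * e j.-1) - E * e j.
  by rewrite ej; ring.
rewrite [RHS]mulrCA.
have -> : (j.+1 * (a + j.+1))%:R / 2 * (laguerre j.+1 a).[2 * E] =
    (2 * j + 1 + a)%:R / 2 * (laguerre j a).[2 * E]
    - 2^-1 * ((0 < j)%:R * (laguerre j.-1 a).[2 * E])
    - E * (laguerre j a).[2 * E].
  by rewrite horner_laguerre_rec; ring.
by rewrite (IHj j) ?(IHj j.-1) //; [ring | lia | lia | lia].
Qed.

(* The coefficient of s^k p in H (s^j p), up to the terms from Laplacian p. *)
Definition tridiag {C : numClosedFieldType} (d j k : nat) : C :=
  ((d + 2 * j)%:R / 2 + 2) *+ (k == j) - 2^-1 *+ (k == j.+1)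
  - ((j * (j + 3 + d))%:R / 2) *+ (j == k.+1).

(** The condition [e n = 0] supplies the missing neighbour of the last index, so one formula serves
    for every k < n. *)
Lemma sum_tridiag (C : numClosedFieldType) (d n k : nat) (e : nat -> C) :
  (k < n)%N -> e n = 0 ->
  \sum_(j < n) e j * tridiag d j k =
  (2 * k + 1 + (d + 3))%:R / 2 * e k - 2^-1 * ((0 < k)%:R * e k.-1)
  - 2^-1 * ((k.+1 * (d + 3 + k.+1))%:R * e k.+1).
Proof.
move=> lt_kn en0; rewrite /tridiag.
have pick (F : nat -> C) i : F n = 0 -> (i <= n)%N ->
    \sum_(j < n) F j *+ (j == i :> nat) = F i.
  move=> Fn0; rewrite leq_eqVlt => /predU1P[->|lt_in].
    rewrite Fn0 big1 // => j _; by rewrite (ltn_eqF (ltn_ord j)).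
  rewrite (bigD1 (Ordinal lt_in)) //= eqxx mulr1n big1 ?addr0 // => j nj.
  by have /negPf -> : (j != i :> nat).
under eq_bigr => j _ do rewrite !mulrBr !mulrnAr.
rewrite !sumrB; congr (_ - _ - _).
- under eq_bigr => j _ do rewrite eq_sym.
  rewrite (pick (fun j => e j * ((d + 2 * j)%:R / 2 + 2))) ?en0 ?mul0r //.
    by field.
  exact: ltnW.
- case: k lt_kn => [|k] lt_kn /=.
    by rewrite mul0r mulr0 big1.
  under eq_bigr => j _ do rewrite eqSS eq_sym.
  rewrite (pick (fun j => e j * 2^-1)) ?en0 ?mul0r 1?ltnW 1?ltnW //.
  by ring.
rewrite (pick (fun j => e j * ((j * (j + 3 + d))%:R / 2))) ?en0 ?mul0r //.
by field.
Qed.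

(** * Eigenvalues of a block triangular matrix with tridiagonal blocks *)

Lemma mx_inj_or_surj (F : fieldType) (I : finType) (a : I -> I -> F) :
  (exists2 x : I -> F, (exists i, x i != 0) & forall j, \sum_i x i * a i j = 0)
  \/ (forall y : I -> F, exists x : I -> F, forall j, \sum_i x i * a i j = y j).
Proof.
pose A : 'M[F]_#|I| := \matrix_(i, j) a (enum_val i) (enum_val j).
have sumE (v : 'rV[F]_#|I|) j :
    \sum_i v 0 (enum_rank i) * a i j = (v *m A) 0 (enum_rank j).
  rewrite mxE (reindex (@enum_val I I)) /=; last first.
    exact: onW_bij (enum_val_bij I).
  by apply: eq_bigr => i _; rewrite enum_valK mxE enum_rankK.
have [uA|] := boolP (A \in unitmx).
  right=> y; pose v := (\row_j y (enum_val j)) *m invmx A.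
  exists (fun i => v 0 (enum_rank i)) => j.
  by rewrite sumE mulmxKV // mxE enum_rankK.
rewrite -row_free_unit -kermx_eq0 => /rowV0Pn[v /sub_kermxP vA0 v0]; left.
exists (fun i => v 0 (enum_rank i)) => [|j]; last by rewrite sumE vA0 mxE.
have /rV0Pn[i vi] := v0; by exists (enum_val i); rewrite enum_valK.
Qed.

Section BlockTridiag.

Variables (C : numClosedFieldType) (B : finType) (N : nat) (d : B -> nat).
Variables (M : B * 'I_N.+1 -> B * 'I_N.+1 -> C) (E : C).

Let P (x : B * 'I_N.+1) := (d x.1 + 2 * x.2 <= N)%N.
Let L b j := (laguerre j (d b + 3)).[2 * E] : C.

Hypothesis M_diag : forall x y, P x -> P y -> x.1 = y.1 ->
  M x y = tridiag (d x.1) x.2 y.2.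
Hypothesis M_trig : forall x y, P x -> P y -> x.1 <> y.1 ->
  (d x.1 <= d y.1)%N -> M x y = 0.

(** Block b of c as a sequence; the value 0 past the cut is the boundary condition that selects the
    eigenvalues. *)
Let ext (c : B * 'I_N.+1 -> C) b j :=
  if (d b + 2 * j <= N)%N then c (b, inord j) else 0.

Let extE c x : P x -> ext c x.1 x.2 = c x.
Proof. by case: x => b j; rewrite /ext /P /= => ->; rewrite inord_val. Qed.

Let sum_block (c : B * 'I_N.+1 -> C) (y : B * 'I_N.+1) :
  P y ->
  (forall x, P x -> x.1 <> y.1 -> c x * M x y = 0) ->
  let e := ext c y.1 in let k : nat := y.2 in
  \sum_(x | P x) c x * M x y =
  (2 * k + 1 + (d y.1 + 3))%:R / 2 * e k - 2^-1 * ((0 < k)%:R * e k.-1)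
  - 2^-1 * ((k.+1 * (d y.1 + 3 + k.+1))%:R * e k.+1).
Proof.
case: y => b k Py c0 /=.
rewrite (bigID (fun x => x.1 == b)) /= [X in _ + X]big1 ?addr0; last first.
  by move=> x /andP[Px /eqP nx]; apply: c0.
rewrite -(@sum_tridiag _ _ N.+1) //; last by rewrite /ext ifF //; lia.
rewrite (reindex_onto (fun j => (b, j)) snd) /=; last first.
  by case=> b' j /andP[_ /eqP /= ->].
rewrite big_mkcond; apply: eq_bigr => j _.
rewrite !eqxx !andbT /ext /P /=; case: ifP => [Pj|_]; last by rewrite mul0r.
by rewrite inord_val M_diag.
Qed.

Let residual (c : B * 'I_N.+1 -> C) y := \sum_(x | P x) c x * M x y - E * c y.

(* In the highest block where c does not vanish, c solves the recurrence. *)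
Let root_of_eigen c : (exists2 x, P x & c x != 0) ->
  (forall y, P y -> residual c y = 0) ->
  exists2 b, (d b <= N)%N & L b ((N - d b) %/ 2).+1 = 0.
Proof.
move=> [x0 Px0 cx0] cE.
pose Q x := P x && (c x != 0).
have Qx0 : Q x0 by rewrite /Q Px0.
(* By maximality every other block in the support of c has d at most [d b], so by [M_trig] it
   contributes nothing to block b. *)
case: (@arg_maxnP _ x0 Q (fun x => d x.1) Qx0) => -[b j] /andP[Px cx] max.
have le_db : (d b <= N)%N by move: Px; rewrite /P /=; lia.
exists b => //; set J := ((N - d b) %/ 2)%N.
have PJ k : (k <= J)%N = (d b + 2 * k <= N)%N by rewrite /J; lia.
have eE k : (k <= J)%N -> E * ext c b k =
    (2 * k + 1 + (d b + 3))%:R / 2 * ext c b k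
    - 2^-1 * ((0 < k)%:R * ext c b k.-1)
    - 2^-1 * ((k.+1 * (d b + 3 + k.+1))%:R * ext c b k.+1).
  move=> le_kJ; have lt_kN : (k < N.+1)%N by move: le_kJ; rewrite PJ; lia.
  have Py : P (b, Ordinal lt_kN) by rewrite /P /= -PJ.
  have := cE _ Py; rewrite /residual sum_block //= => [/eqP|x Px' nx].
    by rewrite subr_eq0 => /eqP ->; rewrite -(extE c Py).
  have [cx'|cx'] := eqVneq (c x) 0; first by rewrite cx' mul0r.
  by rewrite M_trig ?mulr0 //; apply: max; rewrite /Q Px'.
have eL := laguerre_rec_unique eE.
have /eqP : ext c b J.+1 = 0 by rewrite /ext -PJ ltnn.
rewrite eL // mulf_eq0 => /orP[|/eqP //].
(* If the initial coefficient vanished, so would the whole block, against [c (b, j) != 0]. *)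
move=> /eqP e0; case/eqP: cx; rewrite -(extE c Px) /= eL.
  by rewrite e0 mul0r.
by rewrite leqW // PJ.
Qed.

(* Either E is already an eigenvalue of the part below block b, or M - E is   *)
(* invertible there and the Laguerre vector of block b can be corrected.      *)
Let eigen_of_root b : (d b <= N)%N -> L b ((N - d b) %/ 2).+1 = 0 ->
  exists2 c, (exists2 x, P x & c x != 0) & forall y, P y -> residual c y = 0.
Proof.
move=> le_db Lb0; pose low x := P x && (d x.1 < d b)%N.
have M_low x y : low x -> P y -> ~~ low y -> M x y = 0.
  move=> /andP[Px ltx] Py; rewrite /low Py /= -leqNgt => lty.
  apply: M_trig => // [E'|]; last exact: leq_trans (ltnW ltx) lty.
  by move: lty; rewrite -E' leqNgt ltx.
(* M - E on the blocks below b, padded with the identity: kernel vectors, and solutions with a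
   right-hand side supported on [low], then vanish outside [low]. *)
pose a x y := if low x && low y then M x y - E * (x == y)%:R else (x == y)%:R.
have aE (c : B * 'I_N.+1 -> C) y : \sum_x c x * a x y =
    if low y then \sum_(x | low x) c x * M x y - E * c y else c y.
  have deltaE (e : B * 'I_N.+1 -> C) : \sum_x e x * (x == y)%:R = e y.
    rewrite (bigD1 y) //= eqxx mulr1 big1 ?addr0 // => x /negPf ->.
    by rewrite mulr0.
  case: ifP => ly; last first.
    by rewrite -[RHS]deltaE; apply: eq_bigr => x _; rewrite /a ly andbF.
  rewrite -(deltaE (fun x => E * c x)) [X in X - _]big_mkcond -sumrB.
  apply: eq_bigr => x _; rewrite /a ly andbT; case: ifP => lx; first by ring.
  have [xy|nxy] := eqVneq x y; first by rewrite xy ly in lx.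
  by rewrite !mulr0 subrr.
have low_residual (c : B * 'I_N.+1 -> C) y : (forall x, ~~ low x -> c x = 0) ->
    P y -> residual c y = if low y then \sum_x c x * a x y else 0.
  move=> c0 Py; rewrite aE /residual.
  have -> : \sum_(x | P x) c x * M x y = \sum_(x | low x) c x * M x y.
    rewrite (bigID (fun x => (d x.1 < d b)%N)) /= [X in _ + X]big1 ?addr0 //.
    by move=> x /andP[_ /negPf nx]; rewrite c0 ?mul0r // /low nx andbF.
  case: (boolP (low y)) => // ly; rewrite (c0 y) // mulr0 subr0.
  by rewrite big1 // => x lx; rewrite M_low ?mulr0.
have [[c [x cx] ca0]|surj] := mx_inj_or_surj a.
  have c0 y : ~~ low y -> c y = 0.
    by move=> /negPf ly; have := ca0 y; rewrite aE ly.
  exists c => [|y Py].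
    exists x => //; have [/andP[]//|lx] := boolP (low x).
    by rewrite c0 ?eqxx in cx.
  by rewrite low_residual // ca0 if_same.
(* The Laguerre vector solves the equations of block b; its residual lives on [low], where z cancels
   it. *)
pose u x := if P x && (x.1 == b) then L b x.2 else 0.
have [z za] := surj (fun y => if low y then - residual u y else 0).
have z0 y : ~~ low y -> z y = 0.
  by move=> /negPf ly; have := za y; rewrite aE ly.
have Pb : P (b, ord0) by rewrite /P /= muln0 addn0.
exists (fun x => u x + z x) => [|y Py].
  exists (b, ord0) => //; rewrite z0 /low /u ?Pb ?ltnn //= eqxx addr0.
  by rewrite /L laguerre0 invr_eq0 pnatr_eq0 -lt0n fact_gt0.
have -> : residual (fun x => u x + z x) y = residual u y + residual z y.
  rewrite /residual (eq_bigr _ (fun x _ => mulrDl (u x) (z x) (M x y))).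
  by rewrite big_split /=; ring.
rewrite (low_residual z) // za; have [_|ly] := boolP (low y).
  by rewrite addrN.
have le_by : (d b <= d y.1)%N by move: ly; rewrite /low Py /= -leqNgt.
rewrite addr0 /residual; have [yb|nyb] := eqVneq y.1 b; last first.
  rewrite [u y]/u (negPf nyb) andbF mulr0 subr0 big1 // => x Px.
  rewrite /u Px /=; case: eqP => [xb|_]; last by rewrite mul0r.
  by rewrite M_trig ?mulr0 ?xb // => by_; rewrite by_ eqxx in nyb.
rewrite sum_block //= => [|x Px nx]; last first.
  by rewrite /u -yb (introF eqP nx) andbF mul0r.
(* At the last index both sides are 0: the left lies past the cut, the right is the root
   hypothesis. *)
have eL k : (k <= ((N - d b) %/ 2).+1)%N -> ext u b k = L b k.
  rewrite leq_eqVlt => /predU1P[->|le_k].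
    by rewrite Lb0 /ext ifF //; lia.
  have le_kN : (d b + 2 * k <= N)%N by lia.
  by rewrite /ext /u /P /= inordK ?le_kN ?eqxx //; lia.
move: (Py); rewrite /P yb => le_y; rewrite -[u y](extE u Py) yb !eL; try lia.
by rewrite /L horner_laguerre_rec; ring.

Qed.

Lemma block_tridiag_eigenvalue :
  (exists2 c : B * 'I_N.+1 -> C, (exists2 x, P x & c x != 0)
     & forall y, P y -> \sum_(x | P x) c x * M x y = E * c y) <->
  exists2 b, (d b <= N)%N &
    (laguerre ((N - d b) %/ 2).+1 (d b + 3)).[2 * E] = 0.
Proof.
split=> [[c cn0 cE]|[b le_db Lb0]].
  by apply: (root_of_eigen cn0) => y Py; rewrite /residual cE // subrr.
have [c cn0 cE] := eigen_of_root le_db Lb0; exists c => // y Py.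
by apply/eqP; rewrite -subr_eq0; apply/eqP/cE.
Qed.

End BlockTridiag.

(** * Polynomial calculus on Fock space and bosonic degree *)

Definition mulp {C : numClosedFieldType} (q : {mpoly C[8]}) (psi : fock C) :
    fock C :=
  [ffun S : {set 'I_8} => q * psi S].

Definition laplacian {C : numClosedFieldType} (psi : fock C) : fock C :=
  \sum_A annB A (annB A psi).

Definition number_op {C : numClosedFieldType} (psi : fock C) : fock C :=
  \sum_A creB A (annB A psi).

(** The polynomial by which (a^dagger a^dagger) multiplies; 1/2 is the normalisation of the
    generators. *)
Definition radial {C : numClosedFieldType} : {mpoly C[8]} :=
  2^-1 *: \sum_A 'X_A * 'X_A.

Section Linearity.
Variable C : numClosedFieldType.

Lemma creB_is_linear A : linear (@creB C A).
Proof.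
by move=> c phi psi; apply/ffunP => S; rewrite !ffunE mulrDr scalerAr.
Qed.
HB.instance Definition _ A :=
  GRing.isLinear.Build C (fock C) (fock C) _ (@creB C A) (creB_is_linear A).

Lemma annB_is_linear A : linear (@annB C A).
Proof. by move=> c phi psi; apply/ffunP => S; rewrite !ffunE linearP. Qed.
HB.instance Definition _ A :=
  GRing.isLinear.Build C (fock C) (fock C) _ (@annB C A) (annB_is_linear A).

Lemma mulp_is_linear q : linear (@mulp C q).
Proof.
by move=> c phi psi; apply/ffunP => S; rewrite !ffunE mulrDr scalerAr.
Qed.
HB.instance Definition _ q :=
  GRing.isLinear.Build C (fock C) (fock C) _ (@mulp C q) (mulp_is_linear q).

Lemma laplacian_is_linear : linear (@laplacian C).
Proof.
move=> c phi psi; rewrite /laplacian scaler_sumr -big_split /=.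
by apply: eq_bigr => A _; rewrite !linearP.
Qed.
HB.instance Definition _ :=
  GRing.isLinear.Build C (fock C) (fock C) _ (@laplacian C) laplacian_is_linear.

Lemma number_op_is_linear : linear (@number_op C).
Proof.
move=> c phi psi; rewrite /number_op scaler_sumr -big_split /=.
by apply: eq_bigr => A _; rewrite !linearP.
Qed.
HB.instance Definition _ :=
  GRing.isLinear.Build C (fock C) (fock C) _ (@number_op C) number_op_is_linear.

End Linearity.

Section Operators.
Variable C : numClosedFieldType.
Implicit Types (p q : {mpoly C[8]}) (phi psi : fock C) (A : 'I_8).

Lemma mulpM q1 q2 psi : mulp q1 (mulp q2 psi) = mulp (q1 * q2) psi.
Proof. by apply/ffunP => S; rewrite !ffunE mulrA. Qed.

Lemma mulp1 psi : mulp 1 psi = psi.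
Proof. by apply/ffunP => S; rewrite !ffunE mul1r. Qed.

Lemma mulp_sum I (r : seq I) (P : pred I) (q : I -> {mpoly C[8]}) psi :
  mulp (\sum_(i <- r | P i) q i) psi = \sum_(i <- r | P i) mulp (q i) psi.
Proof.
apply/ffunP => S; rewrite fock_sumE ffunE mulr_suml.
by apply: eq_bigr => i _; rewrite ffunE.
Qed.

Lemma mulpZ c q psi : mulp (c *: q) psi = c *: mulp q psi.
Proof. by apply/ffunP => S; rewrite !ffunE scalerAl. Qed.

Lemma creBE A psi : creB A psi = mulp 'X_A psi.
Proof. by []. Qed.

Lemma annB_mulp A q psi :
  annB A (mulp q psi) = mulp q^`M(A) psi + mulp q (annB A psi).
Proof. by apply/ffunP => S; rewrite !ffunE mderivM. Qed.

Lemma mderivX1 A B : ('X_A : {mpoly C[8]})^`M(B) = (A == B)%:R.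
Proof.
rewrite mderivX mnm1E; case: eqP => [->|_]; last by rewrite scale0r.
have -> : (U_(B) - U_(B) = 0 :> 'X_{1..8})%MM.
  by apply/mnmP=> D; rewrite mnmBE subnn mnm0E.
by rewrite mpolyX0 scale1r.
Qed.

Lemma mderiv_radial A : (radial : {mpoly C[8]})^`M(A) = 'X_A.
Proof.
rewrite /radial mderivZ (raddf_sum (mderiv A)) /=.
rewrite (bigD1 A) //= big1 ?addr0 => [|B /negPf nB].
  rewrite mderivM mderivX1 eqxx mul1r mulr1 -mulr2n -scaler_nat scalerA.
  by rewrite mulVf ?scale1r ?pnatr_eq0.
by rewrite mderivM mderivX1 nB mul0r mulr0 addr0.
Qed.

(** Each derivative of [radial] is ['X_A], so the cross terms are a_A^dagger a_A + a_A a_A^dagger;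
    the eight commutators add up to 8. *)
Lemma laplacian_mulp_radial psi :
  laplacian (mulp radial psi) =
  mulp radial (laplacian psi) + 2 *: number_op psi + 8 *: psi.
Proof.
rewrite /laplacian linear_sum /= /number_op scaler_sumr -big_split /=.
have -> : 8 *: psi = \sum_(A < 8) psi.
  by rewrite sumr_const card_ord scaler_nat.
rewrite -big_split /=; apply: eq_bigr => A _.
rewrite annB_mulp mderiv_radial linearD /= (annB_mulp A radial).
rewrite mderiv_radial -!creBE.
have := annB_creB A A psi; rewrite eqxx scale1r => /eqP.
rewrite subr_eq => /eqP ->.
rewrite scaler_nat mulr2n addrA addrC -addrA; congr (_ + _).
by rewrite addrC [psi + _]addrC !addrA.
Qed.

(** Each annihilator lowers the number operator by 1, and the Laplacian applies two. *)
Lemma number_op_laplacian psi :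
  number_op (laplacian psi) = laplacian (number_op psi) - 2 *: laplacian psi.
Proof.
rewrite /laplacian [LHS]linear_sum scaler_sumr -sumrB /=; apply: eq_bigr => A _.
have comm1 phi : number_op (annB A phi) = annB A (number_op phi) - annB A phi.
  rewrite /number_op linear_sum /= -[X in _ - X]scale1r.
  have -> : 1 *: annB A phi = \sum_B (A == B)%:R *: annB B phi.
    rewrite (bigD1 A) //= eqxx big1 ?addr0 // => B /negPf nB.
    by rewrite eq_sym nB scale0r.
  rewrite -sumrB; apply: eq_bigr => B _.
  by rewrite -annB_creB annB_annB opprB addrC subrK.
by rewrite !comm1 linearB /= scaler_nat mulr2n opprD addrA.
Qed.

Definition fhomog (d : nat) psi := forall S, psi S \is d.-homog.

Lemma euler (d : nat) p : p \is d.-homog -> \sum_A 'X_A * p^`M(A) = d%:R *: p.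
Proof.
move=> /dhomogP hp; rewrite [in RHS](mpolyE p) [in LHS](mpolyE p) scaler_sumr.
under eq_bigr => A _ do rewrite (raddf_sum (mderiv A)) mulr_sumr.
rewrite exchange_big /= big_seq [RHS]big_seq; apply: eq_bigr => m /hp /= dm.
have <- : mdeg m = d := dm; rewrite mdegE natr_sum scaler_suml.
apply: eq_bigr => A _.
rewrite mderivZ mderivX -!scalerAr scalerA mulrC -scalerA.
(* For [m A = 0] the truncated exponent would be wrong, but the coefficient kills the term. *)
have [mA0|mA] := eqVneq (m A) 0%N; first by rewrite mA0 !scale0r.
congr (_ *: (_ *: _)); rewrite -mpolyXD; congr 'X_[_].
apply/mnmP => B; rewrite mnmDE mnmBE mnm1E.
by case: eqP => [<-|_] /=; lia.
Qed.

Lemma number_op_homog d psi : fhomog d psi -> number_op psi = d%:R *: psi.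
Proof.
move=> hpsi; apply/ffunP => S; rewrite fock_sumE ffunE -(euler (hpsi S)).
by apply: eq_bigr => A _; rewrite !ffunE.
Qed.

Lemma mpolyX1_homog A : ('X_A : {mpoly C[8]}) \is 1.-homog.
Proof. by rewrite dhomogX; apply/eqP; apply: mdeg1. Qed.

Lemma radial_homog : (radial : {mpoly C[8]}) \is 2.-homog.
Proof.
apply: dhomogZ; apply: rpred_sum => A _.
by apply: (@dhomogM _ _ _ 1 _ 1); apply: mpolyX1_homog.
Qed.

Lemma mulp_homog d e q psi : q \is e.-homog -> fhomog d psi ->
  fhomog (d + e) (mulp q psi).
Proof. by move=> hq hpsi S; rewrite ffunE addnC dhomogM. Qed.

Lemma radial_exp_homog d j psi : fhomog d psi ->
  fhomog (d + 2 * j) (mulp (radial ^+ j) psi).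
Proof.
by move=> hpsi; apply: mulp_homog => //; apply: dhomogMn radial_homog.
Qed.

(** Moving the Laplacian past the factors one at a time adds 2 (d + 2 i) + 8 for each i < j, with
    sum 2 j (j + 3 + d). *)
Lemma laplacian_radial_exp d j psi : fhomog d psi ->
  laplacian (mulp (radial ^+ j) psi) =
  mulp (radial ^+ j) (laplacian psi)
  + (2 * (j * (j + 3 + d)))%:R *: mulp (radial ^+ j.-1) psi.
Proof.
move=> hpsi; elim: j => [|j IHj]; first by rewrite !mulp1 scale0r addr0.
rewrite exprS -mulpM laplacian_mulp_radial IHj linearD linearZ /=.
rewrite mulpM (number_op_homog (radial_exp_homog j hpsi)) -addrA -addrA.
congr (_ + _); rewrite mulpM scalerA -scalerDl.
case: j {IHj} => [|j].
  by rewrite mul0n scale0r add0r; congr (_ *: _); ring.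
by rewrite -exprS -scalerDl; congr (_ *: _); ring.
Qed.

(** Shared by all words in creation operators: the first clause pulls powers of s out of a brick,
    the second counts its bosonic letters. *)
Definition graded (n : nat) (O : operator C) :=
  (forall q psi, O (mulp q psi) = mulp q (O psi)) /\
  (forall d psi, fhomog d psi -> fhomog (d + n) (O psi)).

Lemma graded_id : graded 0 id.
Proof. by split=> // d psi; rewrite addn0. Qed.

Lemma graded_comp m n O1 O2 : graded m O1 -> graded n O2 ->
  graded (m + n) (fun psi => O1 (O2 psi)).
Proof.
move=> [l1 h1] [l2 h2]; split=> [q psi|d psi hpsi]; first by rewrite l2 l1.
by rewrite addnCA addnC; apply/h1/h2.
Qed.

Lemma graded_sum (I : finType) n (O : I -> operator C) :
  (forall i, graded n (O i)) -> graded n (fun psi => \sum_i O i psi).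
Proof.
move=> gO; split=> [q psi|d psi hpsi].
  by rewrite linear_sum; apply: eq_bigr => i _; have [-> _] := gO i.
by move=> S; rewrite fock_sumE rpred_sum // => i _; have [_] := gO i; apply.
Qed.

Lemma gradedZ n c (O : operator C) :
  graded n O -> graded n (fun psi => c *: O psi).
Proof.
move=> [l h]; split=> [q psi|d psi hpsi S]; first by rewrite l linearZ.
by rewrite ffunE; apply: dhomogZ; apply: h.
Qed.

Lemma graded_creB A : graded 1 (creB A).
Proof.
split=> [q psi|d psi hpsi]; first by rewrite !creBE !mulpM mulrC.
by apply: mulp_homog => //; apply: mpolyX1_homog.
Qed.

Lemma graded_creF A : graded 0 (creF A).
Proof.
split=> [q psi|d psi hpsi].
  by apply/ffunP => S; rewrite !ffunE; case: ifP; rewrite ?mulr0 // scalerAr.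
move=> S; rewrite ffunE addn0; case: ifP => _; last exact: dhomog0.
by apply: dhomogZ; apply: hpsi.
Qed.

Definition is_Ad (l : letter) := if l is Ad then true else false.

Lemma graded_optrace (T : 'I_8 -> 'M[C]_3) (w : seq letter) :
  graded (count is_Ad w) (optrace T (map letter_op w)).
Proof.
(* The induction on the word needs arbitrary matrix entries, not only diagonal ones. *)
apply: graded_sum => i; move: {2}i => j.
elim: w i => [|l w IHw] i /=; first by apply: gradedZ; apply: graded_id.
apply: graded_sum => k; apply: graded_comp (IHw k).
apply: graded_sum => A; apply: gradedZ.
by case: l; [apply: graded_creF|apply: graded_creB].
Qed.
End Operators.

(** * Cut projection, quadratic traces and completeness of the generators *)

Section Gauge.
Variable C : numClosedFieldType.
Implicit Types (p q : {mpoly C[8]}) (phi psi : fock C) (A B : 'I_8).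

Lemma mcoeff_cut_proj N psi S m :
  (cut_proj N psi S)@_m = if (mdeg m <= N)%N then (psi S)@_m else 0.
Proof.
rewrite ffunE (raddf_sum (mcoeff m)) /=.
under eq_bigr => m' _ do rewrite mcoeffZ mcoeffX.
have [mS|/memN_msupp_eq0 m0] := boolP (m \in msupp (psi S)); last first.
  rewrite m0 if_same big_seq_cond big1 // => m' /andP[].
  case: eqP => [->|_ _ _]; last by rewrite mulr0.
  by rewrite m0 mul0r.
rewrite big_mkcond (bigD1_seq m) //= eqxx mulr1 big1 ?addr0 // => m' /negPf ->.
by rewrite mulr0 if_same.
Qed.

Lemma cut_proj_is_linear N : linear (@cut_proj C N).
Proof.
move=> c phi psi; apply/ffunP => S; apply/mpolyP => m.
rewrite mcoeff_cut_proj !ffunE mcoeffD mcoeffZ.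
have := mcoeff_cut_proj N phi S m; have := mcoeff_cut_proj N psi S m.
rewrite !ffunE mcoeffD mcoeffZ => -> ->.
by case: ifP => // _; rewrite mulr0 addr0.
Qed.
HB.instance Definition _ N :=
  GRing.isLinear.Build C (fock C) (fock C) _ (@cut_proj C N)
    (cut_proj_is_linear N).

Lemma cut_proj_homog N d psi : fhomog d psi ->
  cut_proj N psi = if (d <= N)%N then psi else 0.
Proof.
move=> hpsi; apply/ffunP => S; apply/mpolyP => m; rewrite mcoeff_cut_proj.
have [md|/eqP/(dhomog_nemf_coeff (hpsi S)) m0] := mdeg m =P d; last first.
  by rewrite m0 if_same; case: ifP; rewrite ?ffunE ?m0 ?mcoeff0.
by rewrite md; case: ifP; rewrite ?ffunE ?mcoeff0.
Qed.

Variable T : 'I_8 -> 'M[C]_3.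
Hypothesis T_generators : su3_generators T.

Lemma optrace_pair (O1 O2 : 'I_8 -> {linear fock C -> fock C}) psi :
  optrace T [:: (fun A => O1 A : operator C); (fun A => O2 A : operator C)] psi
  = 2^-1 *: \sum_A O1 A (O2 A psi).
Proof.
have [_ _ T2] := T_generators.
rewrite /optrace /= /opmx_mul /opmx_of /opmx1.
transitivity (\sum_A \sum_B \tr (T A *m T B) *: O1 A (O2 B psi)); last first.
  rewrite scaler_sumr; apply: eq_bigr => A _.
  rewrite (bigD1 A) //= T2 eqxx mulr1 big1 ?addr0 // => B /negPf nB.
  by rewrite T2 eq_sym nB mulr0 scale0r.
transitivity (\sum_i \sum_k \sum_A \sum_B
    (T A i k * T B k i) *: O1 A (O2 B psi)).
  apply: eq_bigr => i _; apply: eq_bigr => k _; apply: eq_bigr => A _.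
  rewrite (bigD1 i) //= [X in _ + X]big1 ?addr0 => [|l /negPf nl]; last first.
    by rewrite big1 // => B _; rewrite nl scale0r linear0 scaler0.
  rewrite linear_sum scaler_sumr; apply: eq_bigr => B _.
  by rewrite eqxx scale1r linearZ scalerA.
under eq_bigr => i _ do rewrite exchange_big.
rewrite exchange_big; apply: eq_bigr => A _ /=.
under eq_bigr => i _ do rewrite exchange_big.
rewrite exchange_big; apply: eq_bigr => B _ /=.
rewrite /mxtrace scaler_suml; apply: eq_bigr => i _.
by rewrite mxE scaler_suml.
Qed.

Lemma optrace_creB2 psi : optrace T [:: creB; creB] psi = mulp radial psi.
Proof.
rewrite (optrace_pair (fun A => creB A) (fun A => creB A)).
rewrite /radial mulpZ mulp_sum.
by congr (_ *: _); apply: eq_bigr => A _; rewrite -mulpM.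
Qed.

Lemma hamiltonianE psi : hamiltonian T psi =
  2^-1 *: number_op psi + 2 *: psi - 2^-1 *: mulp radial psi
  - 4^-1 *: laplacian psi.
Proof.
rewrite /hamiltonian optrace_creB2.
rewrite (optrace_pair (fun A => creB A) (fun A => annB A)).
rewrite (optrace_pair (fun A => annB A) (fun A => annB A)).
by rewrite [2^-1 *: (2^-1 *: _)]scalerA; congr (_ - _ *: _); field.
Qed.

(* The T^A and the identity form a basis of the 3 x 3 matrices, with dual     *)
(* basis 2 T^A, 1/3 for the trace form: U W = 1 implies W U = 1.              *)
Lemma mxtrace_sum_generators (X Y : 'M[C]_3) : \tr X = 0 -> \tr Y = 0 ->
  \sum_A \tr (T A *m X) * \tr (T A *m Y) = 2^-1 * \tr (X *m Y).
Proof.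
move=> trX trY; have [_ T1 T2] := T_generators.
have trE (U V : 'M[C]_3) : (mxvec U *m (mxvec V^T)^T) 0 0 = \tr (U *m V).
  rewrite mxE (reindex _ (curry_mxvec_bij _ _)) /= /mxtrace.
  under [RHS]eq_bigr => i _ do rewrite mxE.
  rewrite pair_bigA; apply: eq_bigr => -[i j] _ /=.
  by rewrite mxE !mxvecE mxE.
have sumE (U V : 'M[C]_3) :
    \sum_k mxvec U 0 k * mxvec V^T 0 k = \tr (U *m V).
  by rewrite -trE mxE; apply: eq_bigr => k _; rewrite [_^T k 0]mxE.
pose U1 : 'M[C]_(8, 3 * 3) := \matrix_(A, k) mxvec (T A) 0 k.
pose W1 : 'M[C]_(3 * 3, 8) := \matrix_(k, A) (2 * mxvec (T A)^T 0 k).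
pose U2 : 'M[C]_(1, 3 * 3) := mxvec 1%:M.
pose W2 : 'M[C]_(3 * 3, 1) := 3^-1 *: (mxvec 1%:M^T)^T.
have U1W1 : U1 *m W1 = 1%:M.
  apply/matrixP => A B; rewrite !mxE.
  under eq_bigr => k _ do rewrite !mxE mulrCA.
  by rewrite -mulr_sumr sumE T2 mulrA divff ?mul1r // pnatr_eq0.
have U2W1 : U2 *m W1 = 0.
  apply/matrixP => i A; rewrite !mxE ord1.
  under eq_bigr => k _ do rewrite !mxE mulrCA.
  by rewrite -mulr_sumr sumE mul1mx T1 mulr0.
have U1W2 : U1 *m W2 = 0.
  apply/matrixP => A i; rewrite !mxE ord1.
  under eq_bigr => k _ do rewrite !mxE mulrCA.
  by rewrite -mulr_sumr sumE mulmx1 T1 mulr0.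
have U2W2 : U2 *m W2 = 1%:M.
  apply/matrixP => i j; rewrite !mxE !ord1 eqxx.
  under eq_bigr => k _ do rewrite !mxE mulrCA.
  by rewrite -mulr_sumr sumE mulmx1 mxtrace1 mulVf // pnatr_eq0.
pose U : 'M[C]_(8 + 1) := col_mx U1 U2.
pose W : 'M[C]_(8 + 1) := row_mx W1 W2.
have /mulmx1C WU : U *m W = 1%:M.
  by rewrite mul_col_row U1W1 U2W1 U1W2 U2W2 -scalar_mx_block.
have xW : mxvec X *m W = row_mx (mxvec X *m W1) (mxvec X *m W2).
  by rewrite mul_mx_row.
have Uy : U *m (mxvec Y^T)^T =
    col_mx (U1 *m (mxvec Y^T)^T) (U2 *m (mxvec Y^T)^T).
  by rewrite mul_col_mx.
(* Inserting W U = 1 expands tr(X Y) in the dual bases; the identity component drops out because Y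
   is traceless. *)
have := trE X Y; rewrite -[mxvec X]mulmx1 -WU mulmxA xW -mulmxA Uy mul_row_col.
have -> : U2 *m (mxvec Y^T)^T = 0.
  by apply/matrixP => i j; rewrite !ord1 trE mul1mx trY mxE.
rewrite mulmx0 addr0 => <-; rewrite mxE mulr_sumr; apply: eq_bigr => A _.
rewrite !mxE; under [X in _ = _ * (X * _)]eq_bigr => k _ do rewrite mxE mulrCA.
under [X in _ = _ * (_ * X)]eq_bigr => k _ do rewrite !mxE.
rewrite -mulr_sumr !sumE !mulrA mulVf ?mul1r ?pnatr_eq0 //.
by rewrite [\tr (X *m _)]mxtrace_mulC.
Qed.

(** * The adjoint action commutes with the Laplacian *)

Definition grot (G : 'I_8 -> 'I_8 -> C) A : {mpoly C[8]} :=
  \sum_B G B A *: 'X_B.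

Definition poly_rotate (G : 'I_8 -> 'I_8 -> C) p : {mpoly C[8]} :=
  p \mPo [tuple grot G A | A < 8].

Lemma poly_rotate_is_linear G : linear (poly_rotate G).
Proof. by move=> c p q; rewrite /poly_rotate comp_mpolyD comp_mpolyZ. Qed.
HB.instance Definition _ G :=
  GRing.isLinear.Build C {mpoly C[8]} {mpoly C[8]} _ (poly_rotate G)
    (poly_rotate_is_linear G).

(** The chain rule for a linear substitution: it holds for 1 and the variables, and passes to
    products and linear combinations. *)
Lemma mderiv_poly_rotate G p B :
  (poly_rotate G p)^`M(B) = \sum_A G B A *: poly_rotate G p^`M(A).
Proof.
pose K q := forall B,
  (poly_rotate G q)^`M(B) = \sum_A G B A *: poly_rotate G q^`M(A).
have K1 : K 1.
  move=> B'; rewrite /poly_rotate rmorph1 -mpolyC1 mderivC big1 // => A _.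
  by rewrite mderivC rmorph0 scaler0.
have KM q1 q2 : K q1 -> K q2 -> K (q1 * q2).
  move=> h1 h2 B'; rewrite /poly_rotate rmorphM /= mderivM h1 h2.
  rewrite mulr_suml mulr_sumr -big_split; apply: eq_bigr => A _ /=.
  by rewrite mderivM rmorphD !rmorphM scalerDr scalerAl scalerAr.
have KX A : K 'X_A.
  move=> B'; rewrite /poly_rotate comp_mpolyXU -tnth_nth tnth_mktuple /grot.
  rewrite (raddf_sum (mderiv B')) /= (bigD1 B') //= big1 ?addr0 => [|D nD].
    rewrite mderivZ mderivX1 eqxx [RHS](bigD1 A) //= big1 ?addr0 => [|D nD].
      by rewrite mderivX1 eqxx comp_mpoly1.
    by rewrite mderivX1 eq_sym (negPf nD) comp_mpoly0 scaler0.
  by rewrite mderivZ mderivX1 (negPf nD) scaler0.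
rewrite [in LHS](mpolyE p) [in RHS](mpolyE p).
rewrite (linear_sum (poly_rotate G)) (raddf_sum (mderiv B)) /=.
under [RHS]eq_bigr => A _ do
  rewrite (raddf_sum (mderiv A)) (linear_sum (poly_rotate G)) scaler_sumr /=.
rewrite exchange_big; apply: eq_bigr => m _ /=.
rewrite linearZ mderivZ /=.
have -> : (poly_rotate G 'X_[m])^`M(B) = 
   \sum_A G B A *: poly_rotate G 'X_[m]^`M(A).
  suff : K 'X_[m] by apply.
  rewrite mpolyXE_id; apply: (big_ind K) => // A _.
  by elim: (m A) => [|k IHk]; rewrite ?expr0 // exprS; apply: KM.
rewrite scaler_sumr; apply: eq_bigr => A _.
by rewrite mderivZ /poly_rotate comp_mpolyZ !scalerA mulrC.
Qed.

Definition poly_laplacian p : {mpoly C[8]} := \sum_A p^`M(A)^`M(A).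

Lemma poly_laplacian_rotate G p :
  (forall A A', \sum_B G B A * G B A' = (A == A')%:R) ->
  poly_laplacian (poly_rotate G p) = poly_rotate G (poly_laplacian p).
Proof.
move=> GG; rewrite /poly_laplacian linear_sum /=.
under eq_bigr => B _.
  rewrite mderiv_poly_rotate (raddf_sum (mderiv B)) /=.
  under eq_bigr => A _ do rewrite mderivZ mderiv_poly_rotate scaler_sumr.
  over.
rewrite exchange_big; apply: eq_bigr => A _ /=.
rewrite exchange_big (bigD1 A) //= [X in _ + X]big1 => [|A' nA].
  rewrite addr0; under eq_bigr => B _ do rewrite scalerA.
  by rewrite -scaler_suml GG eqxx scale1r.
under eq_bigr => B _ do rewrite scalerA.
by rewrite -scaler_suml GG eq_sym (negPf nA) scale0r.
Qed.
End Gauge.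

Section Sector.
Local Open Scope sesquilinear_scope.
Variable C : numClosedFieldType.
Variable T : 'I_8 -> 'M[C]_3.
Implicit Types (g : 'M[C]_3) (phi psi : fock C) (A B : 'I_8).

Lemma vacuum_homog : fhomog 0 (vacuum : fock C).
Proof.
by move=> S; rewrite ffunE; case: ifP => _; [apply: dhomog1|apply: dhomog0].
Qed.

Definition rotated_vacuum g (S : {set 'I_8}) : fock C :=
  foldr (rotate T g creF) vacuum (enum S).

Lemma rotated_vacuum_homog g S : fhomog 0 (rotated_vacuum g S).
Proof.
rewrite /rotated_vacuum; elim: (enum S) => [|A s IHs] /=.
  exact: vacuum_homog.
have [_ h] : graded 0 (rotate T g (@creF C) A).
  by apply: graded_sum => B; apply: gradedZ; apply: graded_creF.
exact: (h 0).
Qed.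

(** A rotated a_A^dagger is multiplication by a linear form, so the action splits into a
    substitution in the polynomials and a fermionic state of bosonic degree 0, transparent to the
    Laplacian. *)
Lemma gauge_actE g psi : gauge_act T g psi =
  \sum_S mulp (poly_rotate (adjoint_coef T g) (psi S)) (rotated_vacuum g S).
Proof.
apply: eq_bigr => S _; rewrite /poly_rotate comp_mpolyEX mulp_sum.
apply: eq_bigr => m _; rewrite mulpZ; congr (_ *: _).
rewrite comp_mpolyX /fock_monomial -/(rotated_vacuum g S) -big_enum /=.
elim: (enum 'I_8) => [|A s IHs] /=; first by rewrite big_nil mulp1.
rewrite big_cons -mulpM -IHs tnth_mktuple.
elim: (m A) => [|k IHk] /=; first by rewrite mulp1.
rewrite exprS -mulpM -IHk /rotate /grot mulp_sum.
by apply: eq_bigr => B _; rewrite mulpZ.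
Qed.

Lemma gauge_act_is_linear g : linear (gauge_act T g).
Proof.
move=> c phi psi; rewrite !gauge_actE scaler_sumr -big_split.
apply: eq_bigr => S _; rewrite !ffunE linearP /=.
by apply/ffunP => S'; rewrite !ffunE mulrDl scalerAl.
Qed.
HB.instance Definition _ g :=
  GRing.isLinear.Build C (fock C) (fock C) _ (gauge_act T g)
    (gauge_act_is_linear g).

Lemma annB_homog0 A psi : fhomog 0 psi -> annB A psi = 0.
Proof.
move=> hpsi; apply/ffunP => S; rewrite !ffunE; apply/mpolyP => m.
rewrite mcoeff_mderiv mcoeff0 (dhomog_nemf_coeff (hpsi S)) ?mul0rn //.
by apply/eqP; have := mdegD m U_(A); rewrite mdeg1 /= => ->; lia.
Qed.

Lemma laplacian_mulp_homog0 q psi : fhomog 0 psi ->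
  laplacian (mulp q psi) = mulp (poly_laplacian q) psi.
Proof.
move=> hpsi; rewrite /laplacian /poly_laplacian mulp_sum; apply: eq_bigr => A _.
by rewrite !(annB_mulp, annB_homog0 A hpsi, linear0, addr0).
Qed.

Hypothesis T_generators : su3_generators T.

(** Conjugation by g preserves tracelessness and the trace form; completeness reduces the sum to 2
    tr(T^A T^A'). *)
Lemma adjoint_coef_orthogonal g A A' : SU3 g ->
  \sum_B adjoint_coef T g B A * adjoint_coef T g B A' = (A == A')%:R.
Proof.
move=> [/unitarymxP gg _]; have [_ T1 T2] := T_generators.
have g'g : g^t* *m g = 1%:M := mulmx1C gg.
have tr0 D : \tr (g *m T D *m g^t*) = 0.
  by rewrite mxtrace_mulC mulmxA g'g mul1mx T1.
rewrite /adjoint_coef; under eq_bigr => B _ do rewrite mulrACA.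
rewrite -mulr_sumr mxtrace_sum_generators //.
rewrite -!mulmxA (mulmxA (g^t*)) g'g mul1mx.
by rewrite mxtrace_mulC -!mulmxA g'g mulmx1 T2; field.
Qed.

Lemma laplacian_gauge_act g psi : SU3 g ->
  laplacian (gauge_act T g psi) = gauge_act T g (laplacian psi).
Proof.
move=> su_g; rewrite !gauge_actE linear_sum; apply: eq_bigr => S _ /=.
rewrite laplacian_mulp_homog0; last exact: rotated_vacuum_homog.
rewrite poly_laplacian_rotate => [|A A']; last exact: adjoint_coef_orthogonal.
rewrite fock_sumE; congr (mulp (poly_rotate _ _) _).
by apply: eq_bigr => A _; rewrite !ffunE.
Qed.

Lemma sector0 N nF : sector T N nF 0.
Proof.
split=> [g _|S|S m]; first exact: linear0.
  by rewrite ffunE eqxx.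
by rewrite ffunE msupp0.
Qed.

Lemma sectorD N nF c phi psi : sector T N nF phi -> sector T N nF psi ->
  sector T N nF (c *: phi + psi).
Proof.
move=> [inv1 f1 b1] [inv2 f2 b2]; split=> [g su_g|S|S m].
- by rewrite linearP /= inv1 ?inv2.
- rewrite !ffunE; have [-> | /f1 //] := eqVneq (phi S) 0.
  by rewrite scaler0 add0r; apply: f2.
rewrite !ffunE => /msuppD_le; rewrite mem_cat => /orP[/msuppZ_le/b1|/b2] //.
Qed.

Lemma sector_sum N nF (I : finType) (P : pred I) (c : I -> C)
    (v : I -> fock C) :
  (forall i, P i -> sector T N nF (v i)) ->
  sector T N nF (\sum_(i | P i) c i *: v i).
Proof.
move=> vP; elim/big_rec: _ => [|i psi Pi IH]; first exact: sector0.
by apply: sectorD => //; apply: vP.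
Qed.

Lemma sector_laplacian N nF psi : sector T N nF psi ->
  sector T N nF (laplacian psi).
Proof.
move=> [inv f b]; split=> [g su_g|S|S m].
- by rewrite -laplacian_gauge_act ?inv.
- have [p0|/f //] := eqVneq (psi S) 0.
  rewrite fock_sumE big1 ?eqxx // => A _.
  by rewrite !ffunE p0 !linear0.
rewrite mcoeff_msupp fock_sumE (raddf_sum (mcoeff m)) /=; apply: contraR.
rewrite -ltnNge => lt_N; rewrite big1 // => A _.
rewrite !ffunE !mcoeff_mderiv memN_msupp_eq0 ?mul0rn //.
apply/negP => /b; rewrite !mdegD; lia.
Qed.

End Sector.

(** * The cut Hamiltonian in the brick basis *)

Lemma graded_brick_op (C : numClosedFieldType) (T : 'I_8 -> 'M[C]_3)
    (b : brick) :
  graded (nB b) (brick_op T b).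
Proof.
elim: b => [|w b IHb]; first exact: graded_id.
rewrite /nB /= count_cat; exact: graded_comp (graded_optrace T w) IHb.
Qed.

Lemma brick_vec_homog (C : numClosedFieldType) (T : 'I_8 -> 'M[C]_3)
    (b : brick) k :
  fhomog (nB b + 3 * k) (brick_vec T b 0 k).
Proof.
have [_ h] := graded_brick_op T b; rewrite addnC; apply: h.
elim: k => [|k IHk]; first exact: vacuum_homog.
have [_ h3] := graded_optrace T [:: Ad; Ad; Ad].
by rewrite mulnS addnC; apply: h3.
Qed.

Lemma is_basis_reindex (C : numClosedFieldType) (V : fock C -> Prop)
    (I J : finType) (P : pred I) (Q : pred J) (v : I -> fock C)
    (u : J -> fock C) (h : J -> I) :
  bijective h -> (forall j, Q j = P (h j)) -> (forall j, u j = v (h j)) ->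
  is_basis V P v -> is_basis V Q u.
Proof.
move=> hbij QP uv [vV free gen]; have [h' hK h'K] := hbij.
split=> [j|c c0 j|psi /gen[c ->]]; first by rewrite QP uv; apply: vV.
- have {}c0 : \sum_(i | P i) c (h' i) *: v i = 0.
    rewrite (reindex h) /=; last exact: onW_bij.
    by rewrite -[RHS]c0; apply: eq_big => i; rewrite ?QP ?hK ?uv.
  by rewrite QP => Pj; rewrite -(hK j); apply: free c0 _ Pj.
exists (fun j => c (h j)); rewrite (reindex h) //=; last exact: onW_bij.
by apply: eq_big => j; rewrite ?QP ?uv.
Qed.

(** Dual to [sum_tridiag]: summing over k gives the image of [v j]. At j = 0 the coefficient of
    [v j.-1] vanishes. *)
Lemma sum_tridiag_vec (C : numClosedFieldType) (V : lmodType C) (d n j : nat)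
    (v : nat -> V) : (j < n)%N -> v n = 0 ->
  \sum_(k < n) tridiag d j k *: v k =
  ((d + 2 * j)%:R / 2 + 2) *: v j - 2^-1 *: v j.+1
  - ((j * (j + 3 + d))%:R / 2) *: v j.-1.
Proof.
move=> lt_jn vn0; rewrite /tridiag.
have pick a i : (i <= n)%N ->
    \sum_(k < n) (a *+ (k == i :> nat)) *: v k = a *: v i.
  rewrite leq_eqVlt => /predU1P[->|lt_in].
    rewrite vn0 scaler0 big1 // => k _.
    by rewrite (ltn_eqF (ltn_ord k)) scale0r.
  rewrite (bigD1 (Ordinal lt_in)) //= eqxx big1 ?addr0 // => k nk.
  by have /negPf -> : (k != i :> nat); rewrite ?scale0r.
under eq_bigr => k _ do rewrite !scalerBl.
rewrite !sumrB !pick ?(ltnW lt_jn) //; congr (_ - _).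
case: j lt_jn => [|j] lt_jn.
  by rewrite mul0n mul0r scale0r big1 // => k _; rewrite mul0rn scale0r.
under eq_bigr => k _ do rewrite eqSS eq_sym.
by rewrite pick // ltnW // ltnW.
Qed.

Section CutHamiltonian.
Variables (C : numClosedFieldType) (T : 'I_8 -> 'M[C]_3).
Hypothesis T_generators : su3_generators T.

Lemma brick_vecE b j k :
  brick_vec T b j k = mulp (radial ^+ j) (brick_vec T b 0 k).
Proof.
have [h _] := graded_brick_op T b; rewrite /brick_vec -h; congr brick_op.
elim: j => [|j IHj] /=; first by rewrite mulp1.
by rewrite IHj optrace_creB2 // mulpM exprS.
Qed.

Lemma hamiltonian_is_linear : linear (hamiltonian T).
Proof.
have lin4 (V : lmodType C) (c a1 a2 a3 a4 : C) (x1 x2 x3 x4 y1 y2 y3 y4 : V) :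
    a1 *: (c *: x1 + y1) + a2 *: (c *: x2 + y2) - a3 *: (c *: x3 + y3)
      - a4 *: (c *: x4 + y4) =
    c *: (a1 *: x1 + a2 *: x2 - a3 *: x3 - a4 *: x4)
      + (a1 *: y1 + a2 *: y2 - a3 *: y3 - a4 *: y4).
  have Z a u v : a *: (c *: u + v) = c *: (a *: u) + a *: v :> V.
    by rewrite scalerDr !scalerA mulrC.
  rewrite !Z !scalerBr scalerDr !opprD.
  rewrite (addrACA (c *: (a1 *: x1))) (addrACA _ _ (- (c *: (a3 *: x3)))).
  by rewrite (addrACA _ _ (- (c *: (a4 *: x4)))).
move=> c phi psi; rewrite !hamiltonianE //.
rewrite (linearP number_op) (linearP (mulp radial)) (linearP laplacian).
exact: lin4.
Qed.
HB.instance Definition _ :=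
  GRing.isLinear.Build C (fock C) (fock C) _ (hamiltonian T)
    hamiltonian_is_linear.

(** Setting [v k] to 0 past the cut makes it the projection of s^k p, so the top row needs no
    separate treatment. *)
Lemma cut_hamiltonian_radial N d j p : fhomog d p -> (d + 2 * j <= N)%N ->
  let v k := if (d + 2 * k <= N)%N then mulp (radial ^+ k) p else 0 in
  cut_proj N (hamiltonian T (v j)) =
  \sum_(k < N.+1) tridiag d j k *: v k
  - 4^-1 *: cut_proj N (mulp (radial ^+ j) (laplacian p)).
Proof.
move=> hp le_jN v.
have vE k : v k = cut_proj N (mulp (radial ^+ k) p).
  by rewrite (cut_proj_homog _ (radial_exp_homog k hp)).
rewrite sum_tridiag_vec //; [|lia|by rewrite /v ifF //; lia].
have ham (V : lmodType C) (K : {linear V -> V}) (a m : nat) (x y z l : V) :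
    K (2^-1 *: (a%:R *: x) + 2 *: x - 2^-1 *: y
      - 4^-1 *: (l + (2 * m)%:R *: z)) =
    (a%:R / 2 + 2) *: K x - 2^-1 *: K y - (m%:R / 2) *: K z - 4^-1 *: K l.
  rewrite !(linearB K) (linearD K) !(linearZ_LR K) (linearD K).
  rewrite !(linearZ_LR K) /=.
  rewrite scalerDr opprD !scalerA scalerDl [_ / 2]mulrC !addrA addrAC.
  by congr (_ - _ - _); congr (_ *: _); field.
have vj : v j = mulp (radial ^+ j) p by rewrite /v le_jN.
rewrite hamiltonianE // [in LHS]vj.
rewrite (number_op_homog (radial_exp_homog j hp)) (laplacian_radial_exp j hp).
by rewrite mulpM -exprS !vE; apply: ham.
Qed.

Variables (N nF : nat).

Variables (B : finType) (d : B -> nat) (p : B -> fock C).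
Hypothesis p_homog : forall b, fhomog (d b) (p b).

Let w (b : B) j := mulp (radial ^+ j) (p b).
Let P (x : B * 'I_N.+1) := (d x.1 + 2 * x.2 <= N)%N.

Let w_homog b j : fhomog (d b + 2 * j) (w b j).
Proof. exact: radial_exp_homog. Qed.

Hypothesis w_basis : is_basis (sector T N nF) P (fun x => w x.1 x.2).

(* Comparing number_op on both sides of the expansion of Laplacian p kills    *)
(* the coefficients of the wrong degree, by linear independence.              *)
Let low_laplacian b : (d b <= N)%N -> exists2 c : B * 'I_N.+1 -> C,
  laplacian (p b) = \sum_(x | P x) c x *: w x.1 x.2 &
  forall x, P x -> c x != 0 -> (d x.1 + 2 * x.2 + 2 = d b)%N.
Proof.
move=> le_db; have [sec free gen] := w_basis.
have Pb : P (b, ord0) by rewrite /P /= muln0 addn0.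
have [c cE] := gen _ (sector_laplacian T_generators (sec _ Pb)).
rewrite /= {1}/w mulp1 in cE; exists c; first exact: cE.
have := number_op_laplacian (p b).
rewrite (number_op_homog (p_homog b)) linearZ /= cE linear_sum !scaler_sumr.
rewrite -sumrB => /eqP; rewrite -subr_eq0 -sumrB => /eqP.
under eq_bigr => x _.
  rewrite linearZ /= (number_op_homog (w_homog _ _)) !scalerA -!scalerBl.
  over.
move=> /free c0 x Px cx; have /eqP := c0 x Px.
have -> : c x * (d x.1 + 2 * x.2)%:R - ((d b)%:R * c x - 2 * c x) =
  c x * ((d x.1 + 2 * x.2 + 2)%:R - (d b)%:R) by ring.
rewrite mulf_eq0 (negPf cx) subr_eq0 /= eqr_nat => /eqP ->; lia.
Qed.

Let row x : exists r : B * 'I_N.+1 -> C, P x ->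
  [/\ forall y, P y -> x.1 = y.1 -> r y = tridiag (d x.1) x.2 y.2,
      forall y, P y -> x.1 <> y.1 -> (d x.1 <= d y.1)%N -> r y = 0
    & cut_proj N (hamiltonian T (w x.1 x.2)) = \sum_(y | P y) r y *: w y.1 y.2].
Proof.
case: x => b j; have [Px|] := boolP (P (b, j)); last by exists (fun _ => 0).
have le_db : (d b <= N)%N by move: Px; rewrite /P /=; lia.
have [c lapE c_low] := low_laplacian le_db.
(* The coefficients of (a^dagger a^dagger)^j applied to [laplacian (p b)]: the expansion [c] with
   its second index shifted by j. *)
pose s (y : B * 'I_N.+1) : C :=
  \sum_(x | P x) c x *+ ((y.1 == x.1) && (y.2 == x.2 + j :> nat)%N).
have s0 y : (d b <= d y.1)%N -> s y = 0.
  move=> le_by; rewrite /s big1 // => x Px'; case: eqP => //= yx.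
  have [->|cx] := eqVneq (c x) 0; first by rewrite mul0rn.
  move: le_by; rewrite yx -(c_low x Px' cx) leqNgt addn2 ltnS leqW //.
  exact: leq_addr.
exists (fun y : B * 'I_N.+1 =>
  (if b == y.1 then tridiag (d b) j y.2 else 0) - 4^-1 * s y) => _.
split=> [y Py /= eb|y Py /= /eqP/negPf -> le_by|/=].
- by rewrite s0 -eb // eqxx mulr0 subr0.
- by rewrite s0 // mulr0 subr0.
have := cut_hamiltonian_radial (p_homog b) Px.
rewrite /= ifT // -/(w b j) => ->.
under [RHS]eq_bigr => y _ do rewrite scalerBl.
rewrite sumrB; congr (_ - _).
  rewrite [RHS](bigID (fun y => y.1 == b)) /= [X in _ + X]big1 ?addr0;
      last first.
    by move=> y /andP[_ /negPf nb]; rewrite eq_sym nb scale0r.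
  rewrite [RHS](reindex_onto (fun k => (b, k)) snd) /=; last first.
    by case=> b' k /andP[_ /eqP /= ->].
  rewrite [RHS]big_mkcond; apply: eq_bigr => k _.
  by rewrite !eqxx !andbT /P /=; case: ifP => _ //; rewrite scaler0.
under [RHS]eq_bigr => y _ do rewrite -scalerA scaler_suml.
rewrite -scaler_sumr exchange_big /=; congr (_ *: _).
rewrite lapE linear_sum linear_sum; apply: eq_bigr => x Px'.
rewrite !linearZ /=; have [cx0|cx] := eqVneq (c x) 0.
  by rewrite cx0 scale0r big1 // => y _; rewrite mul0rn scale0r.
(* The shifted vector has degree d b + 2 j - 2, so the cut leaves it intact. *)
have le_N : (d x.1 + 2 * (x.2 + j) <= N)%N.
  by move: Px; rewrite /P /= -(c_low x Px' cx); lia.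
have lt_N : (x.2 + j < N.+1)%N by lia.
rewrite (bigD1 (x.1, Ordinal lt_N)) //= !eqxx big1 ?addr0 => [|y /andP[_ ny]].
  rewrite mulr1n [in LHS]/w mulpM -exprD addnC -/(w x.1 _).
  by rewrite (cut_proj_homog _ (w_homog _ _)) le_N.
have /negPf -> : ~~ ((y.1 == x.1) && (y.2 == x.2 + j :> nat)%N).
  apply: contra ny => /andP[/eqP y1 /eqP y2]; apply/eqP.
  by case: y y1 y2 => y1 y2 /= -> e; congr (_, _); apply: val_inj.
by rewrite scale0r.
Qed.

(** Coordinates form a row vector acted on by M from the right; freeness of the basis turns the
    eigenvector equation into equations on coefficients. *)
Lemma cut_eigenvalue_laguerre E :
  cut_eigenvalue T N nF E <->
  exists2 b, (d b <= N)%N &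
    (laguerre ((N - d b) %/ 2).+1 (d b + 3)).[2 * E] = 0.
Proof.
have [M ME] := fin_all_exists row; have [sec free gen] := w_basis.
have M_diag x y : P x -> P y -> x.1 = y.1 -> M x y = tridiag (d x.1) x.2 y.2.
  by move=> /(ME x)[h _ _] Py; apply: h.
have M_trig x y : P x -> P y -> x.1 <> y.1 -> (d x.1 <= d y.1)%N -> M x y = 0.
  by move=> /(ME x)[_ h _] Py; apply: h.
rewrite -(block_tridiag_eigenvalue E M_diag M_trig).
have actE c : cut_proj N (hamiltonian T (\sum_(x | P x) c x *: w x.1 x.2)) =
    \sum_(y | P y) (\sum_(x | P x) c x * M x y) *: w y.1 y.2.
  have -> : hamiltonian T (\sum_(x | P x) c x *: w x.1 x.2) =
      \sum_(x | P x) c x *: hamiltonian T (w x.1 x.2).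
    by rewrite linear_sum; apply: eq_bigr => x _; rewrite linearZ.
  rewrite linear_sum.
  under [RHS]eq_bigr => y _ do rewrite scaler_suml.
  rewrite exchange_big; apply: eq_bigr => x Px /=.
  have [_ _ xE] := ME x Px; rewrite linearZ /= xE scaler_sumr.
  by apply: eq_bigr => y _; rewrite scalerA.
split=> [[psi [/gen[c ->] psi0 psiE]]|[c [x Px cx] cE]].
  exists c.
    apply/exists_inP; apply: contraNT psi0 => /exists_inPn c0.
    by rewrite big1 // => x /c0; rewrite negbK => /eqP ->; rewrite scale0r.
  move=> y Py; apply/eqP; rewrite -subr_eq0; apply/eqP; move: y Py.
  apply: free; under eq_bigr => y _ do rewrite scalerBl -scalerA.
  by rewrite sumrB -actE psiE scaler_sumr subrr.
exists (\sum_(x | P x) c x *: w x.1 x.2); split; first exact: sector_sum.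
  by apply: contra cx => /eqP/free/(_ x Px) ->.
rewrite actE scaler_sumr; apply: eq_bigr => y Py.
by rewrite cE // scalerA.
Qed.

End CutHamiltonian.

(** A product vanishes when a factor does. The filter on bricks and the range of k together say that
    nB + 3 k is at most N. *)
Lemma root_Theta (C : numClosedFieldType) (N nF : nat) (E : C) :
  root (Theta N nF) E <->
  exists2 b : 'I_(size (bricks nF)) * 'I_N.+1,
    let d := (nB (nth [::] (bricks nF) b.1) + 3 * b.2)%N in (d <= N)%N &
    let d := (nB (nth [::] (bricks nF) b.1) + 3 * b.2)%N in
    (laguerre ((N - d) %/ 2).+1 (d + 3)).[2 * E] = 0.
Proof.
rewrite rootE /Theta (big_nth [::]) horner_prod prodf_seq_eq0.
have factorE b k : (laguerre ((N - 3 * k - nB b) %/ 2).+1 (3 * k + 3 + nB b)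
      \Po (2 *: 'X)).[E] =
    (laguerre ((N - (nB b + 3 * k)) %/ 2).+1 (nB b + 3 * k + 3)).[2 * E] :> C.
  rewrite horner_comp hornerZ hornerX -subnDA.
  by congr (laguerre (_ %/ 2).+1 _).[_]; lia.
split=> [/hasP hi|[[b k] /= le_N L0]].
  case: hi => i; rewrite mem_index_iota /= => lt_i /andP[le_bN].
  rewrite horner_prod prodf_seq_eq0 => /hasP[k].
  rewrite mem_index_iota /= factorE => lt_k /eqP L0.
  have lt_kN : (k < N.+1)%N by lia.
  by exists (Ordinal lt_i, Ordinal lt_kN); rewrite /= //; lia.
apply/hasP; exists (b : nat); first by rewrite mem_index_iota /=.
apply/andP; split; first by lia.
rewrite horner_prod prodf_seq_eq0; apply/hasP; exists (k : nat).
  by rewrite mem_index_iota /=; lia.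
by rewrite /= factorE L0.
Qed.

Local Open Scope complex_scope.

Theorem mainTheorem3 (R : realType) (T : 'I_8 -> 'M[R[i]]_3) (N nF : nat)
    (T_generators : su3_generators T) (nF_le4 : (nF <= 4)%N)
    (bricks_basis : brick_basis T N nF) (E : R[i]) :
  cut_eigenvalue T N nF E <-> root (Theta N nF) E.
Proof.
rewrite root_Theta; pose b0 b := nth [::] (bricks nF) b.
pose d (b : 'I_(size (bricks nF)) * 'I_N.+1) := (nB (b0 b.1) + 3 * b.2)%N.
pose p (b : 'I_(size (bricks nF)) * 'I_N.+1) := brick_vec T (b0 b.1) 0 b.2.
apply: (@cut_eigenvalue_laguerre _ T T_generators N nF _ d p).
  by move=> b; apply: brick_vec_homog.
(* A block is a pair (brick, k) with j running inside it, whereas [brick_basis] lists j before k. *)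
pose h (y : 'I_(size (bricks nF)) * 'I_N.+1 * 'I_N.+1) := (y.1.1, y.2, y.1.2).
apply: (is_basis_reindex (h := h) _ _ _ bricks_basis) => [|y|y] /=.
- by exists h => -[[]].
- by rewrite /d addnC (addnC (nB _)) addnA.
by rewrite [RHS]brick_vecE.
Qed.
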